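(* Let $T=(T_1,\ldots,T_d)$ be a commuting row contraction on some Hilbert space $\mathcal{H}$ with minimal co-extension $M_z^{(\kappa)}\oplus U$ acting on $\mathcal{K}_1\oplus\mathcal{K}_2$. Assume that $\mathcal{H}_u\subset\mathcal{H}$ is a reducing subspace for $T$ such that $T|_{\mathcal{H}_u}$ is a spherical unitary and $T|_{\mathcal{H}\ominus\mathcal{H}_u}$ is completely non-unitary. Then $$\mathcal{H}_u=\mathcal{K}_2\ominus\bigvee_{\alpha\in\mathbb{N}^d}U^{\alpha*}\bigl(\mathcal{K}_2\ominus(\mathcal{H}\cap\mathcal{K}_2)\bigr).$$
   Context: $d\ge1$ is an integer. The Drury-Arveson space $H^2_d$ is the reproducing kernel Hilbert space of holomorphic functions on the open unit ball $\mathbb{B}_d\subset\mathbb{C}^d$ with kernel $k(z,w)=1/(1-\langle z,w\rangle)$. $M_z=(M_{z_1},\ldots,M_{z_d})$ is the $d$-tuple of multiplication operators by the coordinate functions on $H^2_d$, and $M_z^{(\kappa)}$ is the direct sum of $\kappa$ copies of it, acting on $(H^2_d)^{(\kappa)}$. A commuting row contraction on a Hilbert space $\mathcal{H}$ is a $d$-tuple $T=(T_1,\ldots,T_d)$ of commuting operators in $B(\mathcal{H})$ with $\sum_k T_kT_k^*\le I$. A spherical unitary is a commuting $d$-tuple $U=(U_1,\ldots,U_d)$ of normal operators with $\sum_k U_kU_k^*=I$. A commuting row contraction is completely non-unitary if it has no (nonzero closed) invariant subspace on which it restricts to a spherical unitary. Every commuting row contraction $T$ on $\mathcal{H}$ has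 a co-extension $M_z^{(\kappa)}\oplus U$, where $\kappa$ is a cardinal and $U$ is a spherical unitary (possibly on the space $\{0\}$), acting on $\mathcal{K}_1\oplus\mathcal{K}_2$ with $\mathcal{K}_1=(H^2_d)^{(\kappa)}$ the space of $M_z^{(\kappa)}$ and $\mathcal{K}_2$ the space of $U$: up to unitary equivalence, $\mathcal{H}$ is a subspace of $\mathcal{K}_1\oplus\mathcal{K}_2$ invariant under each $(M_{z_k}^{(\kappa)}\oplus U_k)^*$, and $T_k^*=(M_{z_k}^{(\kappa)}\oplus U_k)^*|_{\mathcal{H}}$ for $1\le k\le d$. The co-extension is minimal if $\mathcal{K}_1\oplus\mathcal{K}_2$ is the smallest reducing subspace for $M_z^{(\kappa)}\oplus U$ containing $\mathcal{H}$; the minimal co-extension exists and is essentially unique. $\mathcal{K}_2$ is identified with $\{0\}\oplus\mathcal{K}_2$. For a multi-index $\alpha\in\mathbb{N}^d$ (with $0\in\mathbb{N}$), $U^\alpha=U_1^{\alpha_1}\cdots U_d^{\alpha_d}$ and $U^{\alpha*}=(U^\alpha)^*$; $\bigvee$ denotes closed linear span and $\mathcal{X}\ominus\mathcal{Y}$ the orthogonal complement of $\mathcal{Y}$ in $\mathcal{X}$. *)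

(* Defs.v *)
From HB Require Import structures.
From mathcomp Require Import all_boot all_order all_algebra.
From mathcomp Require Import complex.
From mathcomp Require Import all_classical all_reals all_analysis.
From mathcomp Require Import ring.

Set Implicit Arguments.
Unset Strict Implicit.
Unset Printing Implicit Defensive.

Import Order.TTheory GRing.Theory Num.Theory.
Import numFieldNormedType.Exports.

Local Open Scope classical_set_scope.
Local Open Scope complex_scope.
Local Open Scope ring_scope.

HB.mixin Record isHilbert (R : realType) V
    & CompleteNormedModule R[i] V := {
  dot : V -> V -> R[i] ;
  dot_linearl : forall (a : R[i]) (x y z : V),
    dot (a *: x + y) z = a * dot x z + dot y z ;
  dot_conj : forall x y : V, dot y x = Num.conj (dot x y) ;
  dot_norm : forall x : V, dot x x = `|x| ^+ 2
}.

#[short(type="hilbertType")]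
HB.structure Definition Hilbert (R : realType) :=
  {V of isHilbert R V & CompleteNormedModule R[i] V}.

Fact cauchy_schwarz_identity (F : fieldType) (n p q m : F) : m != 0 ->
  n - q / m * p - (p / m * q - p / m * (q / m * m)) = n - p * q / m.
Proof. by move=> m0; field. Qed.

Section HilbertTheory.
Context (R : realType) (E : hilbertType R).
Local Notation C := R[i].
Implicit Types (x y z : E) (a : C).

Lemma dotDl x y z : dot (x + y) z = dot x z + dot y z.
Proof. by rewrite -{1}(scale1r x) dot_linearl mul1r. Qed.

Lemma dot0l x : dot (0 : E) x = 0.
Proof. by apply: (addrI (dot 0 x)); rewrite -dotDl !addr0. Qed.

Lemma dotZl a x z : dot (a *: x) z = a * dot x z.
Proof. by rewrite -{1}(addr0 (a *: x)) dot_linearl dot0l addr0. Qed.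

Lemma dotNl x z : dot (- x) z = - dot x z.
Proof. by rewrite -scaleN1r dotZl mulN1r. Qed.

Lemma dotBl x y z : dot (x - y) z = dot x z - dot y z.
Proof. by rewrite dotDl dotNl. Qed.

Lemma dotDr x y z : dot x (y + z) = dot x y + dot x z.
Proof. by rewrite dot_conj dotDl rmorphD /= -!dot_conj. Qed.

Lemma dotZr a x y : dot x (a *: y) = Num.conj a * dot x y.
Proof. by rewrite dot_conj dotZl rmorphM /= -!dot_conj. Qed.

Lemma dot0r x : dot x (0 : E) = 0.
Proof. by rewrite dot_conj dot0l rmorph0. Qed.

Lemma dotNr x z : dot x (- z) = - dot x z.
Proof. by rewrite dot_conj dotNl rmorphN /= -dot_conj. Qed.

Lemma dotBr x y z : dot x (y - z) = dot x y - dot x z.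
Proof. by rewrite dotDr dotNr. Qed.

Lemma cauchy_schwarz x y : `|dot x y| <= `|x| * `|y|.
Proof.
have [->|y0] := eqVneq y 0; first by rewrite dot0r !normr0 mulr0.
have ny0 : 0 < `|y| by rewrite normr_gt0.
pose a := dot x y / `|y| ^+ 2.
have : 0 <= dot (x - a *: y) (x - a *: y) by rewrite dot_norm exprn_ge0.
have ca : Num.conj a = Num.conj (dot x y) / `|y| ^+ 2.
  rewrite /a rmorphM fmorphV rmorphXn/=; congr (_ / _ ^+ _).
  by apply: CrealP; exact: normr_real.
have -> : dot (x - a *: y) (x - a *: y) =
    `|x| ^+ 2 - `|dot x y| ^+ 2 / `|y| ^+ 2.
  rewrite !dotBl !dotBr !dotZl !dotZr !dot_norm (dot_conj x y) ca /a.
  rewrite normCK.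
  have y2 : `|y| ^+ 2 != 0 by rewrite expf_neq0// gt_eqF.
  exact: cauchy_schwarz_identity.
rewrite subr_ge0 ler_pdivrMr ?exprn_gt0// -exprMn.
by rewrite ler_sqr ?nnegrE ?mulr_ge0.
Qed.

Lemma continuous_dotl y : continuous (fun x : E => (dot x y : C^o)).
Proof.
move=> x; apply/cvgrPdist_lt => e e0; near=> z.
rewrite -dotBl (le_lt_trans (cauchy_schwarz _ _))//.
rewrite (@le_lt_trans _ _ (`|x - z| * (`|y| + 1)))//.
  by rewrite ler_wpM2l// lerDl.
rewrite -ltr_pdivlMr ?ltr_pwDr//.
by near: z; apply: cvgr_dist_lt => //; rewrite divr_gt0// ltr_pwDr.
Unshelve. all: by end_near. Qed.

Definition bounded_op (A : E -> E) := linear A /\ continuous A.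

(* By the Riesz representation theorem [adj A] is the Hilbert space adjoint of
   [A] whenever [A] is a bounded operator. *)
Definition adj (A : E -> E) (y : E) : E :=
  xget 0 [set z | forall x, dot (A x) y = dot x z].

Definition orthc (A : set E) : set E := [set x | forall y, A y -> dot x y = 0].

Definition lspan (A : set E) : set E :=
  [set x | exists n (a : 'I_n -> C) (v : 'I_n -> E),
     (forall i, A (v i)) /\ x = \sum_(i < n) a i *: v i].

Definition cspan (A : set E) : set E := closure (lspan A).

End HilbertTheory.

Definition isometry (R : realType) (E F : hilbertType R) (j : E -> F) :=
  linear j /\ forall x y, dot (j x) (j y) = dot x y.

Record csubspace (R : realType) (E : hilbertType R) := CSubspace {
  cs_set :> set E ;
  cs_zero : cs_set 0 ;
  cs_lin : forall (a : R[i]) (x y : E),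
    cs_set x -> cs_set y -> cs_set (a *: x + y) ;
  cs_closed : closed cs_set
}.

Section Subspace.
Context (R : realType) (E : hilbertType R) (M : csubspace E).

Definition cs_pred : {pred E} := fun x => `[< cs_set M x >].

Lemma cs_predP x : reflect (cs_set M x) (x \in cs_pred).
Proof. exact: asboolP. Qed.

Fact cs_pred_submod : submod_closed cs_pred.
Proof.
split; first by apply/cs_predP; exact: cs_zero.
by move=> a x y /cs_predP Mx /cs_predP My; apply/cs_predP; exact: cs_lin.
Qed.

HB.instance Definition _ := GRing.isSubmodClosed.Build R[i] E cs_pred
  (GRing.submod_closed_semi cs_pred_submod).

Record subhilb := SubHilb { sh_val : E ; _ : sh_val \in cs_pred }.

HB.instance Definition _ := [isSub for sh_val].
HB.instance Definition _ := [Choice of subhilb by <:].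
HB.instance Definition _ := [SubChoice_isSubLmodule of subhilb by <:].

Lemma subhilbP (x : subhilb) : cs_set M (\val x).
Proof. exact/cs_predP/valP. Qed.

Let norm (x : subhilb) : R[i] := `|\val x|.

Let normD x y : norm (x + y) <= norm x + norm y.
Proof. exact: ler_normD. Qed.

Let normZ (l : R[i]) x : norm (l *: x) = `|l| * norm x.
Proof. exact: normrZ. Qed.

Let norm0 x : norm x = 0 -> x = 0.
Proof. by move/normr0_eq0 => x0; apply: val_inj. Qed.

HB.instance Definition _ :=
  Lmodule_isNormed.Build R[i] subhilb normD normZ norm0.

Let complete (F : set_system subhilb) : ProperFilter F -> cauchy F -> cvg F.
Proof.
move=> FF /cauchyP cF.
have : cauchy ((\val : subhilb -> E) @ F).
  apply/cauchy_exP => e e0; have [x Fx] := cF e e0.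
  exists (\val x); rewrite /= /fmap/=.
  suff <- : ball x e = (\val : subhilb -> E) @^-1` ball (\val x) e by [].
  by rewrite -!ball_normE.
move=> /cauchy_cvg /cvg_ex[/= l Fl].
have Ml : l \in cs_pred.
  apply/cs_predP; apply: (@cs_closed _ _ M) => B /Fl FB.
  have [x Bx] := @filter_ex subhilb F FF _ FB.
  by exists (\val x); split=> //; exact: subhilbP.
apply/cvg_ex; exists (SubHilb Ml); apply/cvgrPdist_lt => e e0.
by move/cvgrPdist_lt : Fl => /(_ e e0).
Qed.

HB.instance Definition _ := Uniform_isComplete.Build subhilb complete.

Let sdot (x y : subhilb) : R[i] := dot (\val x) (\val y).

Let sdot_linearl a x y z : sdot (a *: x + y) z = a * sdot x z + sdot y z.
Proof. exact: dot_linearl. Qed.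

Let sdot_conj x y : sdot y x = Num.conj (sdot x y).
Proof. exact: dot_conj. Qed.

Let sdot_norm x : sdot x x = `|x| ^+ 2.
Proof. exact: dot_norm. Qed.

HB.instance Definition _ :=
  isHilbert.Build R subhilb sdot_linearl sdot_conj sdot_norm.

End Subspace.
Arguments subhilb {R E} M.

Section Complement.
Context (R : realType) (E : hilbertType R) (A : set E).

Fact orthc0 : orthc A 0.
Proof. by move=> y _; rewrite dot0l. Qed.

Fact orthc_lin (a : R[i]) x y :
  orthc A x -> orthc A y -> orthc A (a *: x + y).
Proof. by move=> Ax Ay z Az; rewrite dot_linearl Ax// Ay// mulr0 addr0. Qed.

Fact orthc_closed : closed (orthc A).
Proof.
have -> : orthc A = \bigcap_(y in A) ((fun x => dot x y : R[i]^o) @^-1` [set 0]).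
  by [].
apply: closed_bigI => y _.
apply: preimage_closed => [x _|]; first exact: continuous_dotl.
exact/accessible_closed_set1/hausdorff_accessible/norm_hausdorff.
Qed.

Definition complement : csubspace E := CSubspace orthc0 orthc_lin orthc_closed.
End Complement.

Section Tuples.
Context (R : realType) (d : nat).

Section OneSpace.
Context (E : hilbertType R).
Implicit Types (T : 'I_d -> E -> E).

Definition bounded_tuple T := forall k, bounded_op (T k).

Definition commuting T := forall j k x, T j (T k x) = T k (T j x).

(* The order of [R[i]] makes this say that [I - \sum_k T_k T_k^*] is a positive
   operator. *)
Definition row_contraction T :=
  [/\ bounded_tuple T, commuting T &
      forall x, dot (\sum_k T k (adj (T k) x)) x <= dot x x].

Definition spherical_unitary T :=
  [/\ bounded_tuple T, commuting T,
      forall k x, T k (adj (T k) x) = adj (T k) (T k x) &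
      forall x, \sum_k T k (adj (T k) x) = x].

Definition invariant T (N : set E) := forall k x, N x -> N (T k x).

Definition reducing T (N : set E) :=
  invariant T N /\ invariant (fun k => adj (T k)) N.

(* [T|_N]; meaningful when [N] is invariant for [T]. *)
Definition restr_tuple T (N : csubspace E) : 'I_d -> subhilb N -> subhilb N :=
  fun k x => insubd 0 (T k (\val x)).

Definition opow T (alpha : 'I_d -> nat) : E -> E :=
  \big[(fun A B => A \o B)/id]_(k < d) iter (alpha k) (T k).

End OneSpace.
Arguments restr_tuple {E} T N k x.

Definition cnu (E : hilbertType R) (T : 'I_d -> E -> E) :=
  forall N : csubspace E, invariant T N ->
    spherical_unitary (restr_tuple T N) -> forall x, cs_set N x -> x = 0.

Local Notation point := 'rV[R[i]]_d.

Definition cdot (z w : point) : R[i] := \sum_k z 0 k * Num.conj (w 0 k).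

Definition cball : set point := [set z | cdot z z < 1].

(* The reproducing kernel Hilbert space on [cball] with kernel [1 / (1 - <z, w>)].
   Its elements are functions on [cball] through the injective linear map
   [da_eval]; the values of [da_eval f] outside of [cball] carry no meaning. *)
Record drury_arveson := DruryArveson {
  da_space :> hilbertType R ;
  da_eval : da_space -> point -> R[i] ;
  da_eval_linear : forall (a : R[i]) f g z, cball z ->
    da_eval (a *: f + g) z = a * da_eval f z + da_eval g z ;
  da_eval_inj : forall f g,
    (forall z, cball z -> da_eval f z = da_eval g z) -> f = g ;
  da_holomorphic : forall f z, cball z ->
    differentiable (da_eval f : 'rV[R[i]^o]_d -> R[i]^o) (z : 'rV[R[i]^o]_d) ;
  da_kernel : forall w, cball w -> exists kw : da_space,
    (forall z, cball z -> da_eval kw z = (1 - cdot z w)^-1) /\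
    (forall f, da_eval f w = dot f kw)
}.

Definition coordinate_mult (F : drury_arveson) (M : 'I_d -> F -> F) :=
  bounded_tuple M /\
  forall k f z, cball z -> da_eval (M k f) z = z 0 k * da_eval f z.

(* Hilbert space direct sums are described up to unitary equivalence, by the
   canonical injections of the summands: here [S] is the direct sum of copies
   of [E] indexed by [I]. *)
Definition ampliation (I : Type) (E S : hilbertType R) (inj : I -> E -> S) :=
  [/\ forall i, isometry (inj i),
      forall i j x y, i <> j -> dot (inj i x) (inj j y) = 0 &
      cspan (\bigcup_i range (inj i)) = setT].

Definition direct_sum (E1 E2 S : hilbertType R)
    (inj1 : E1 -> S) (inj2 : E2 -> S) :=
  [/\ isometry inj1, isometry inj2,
      forall x y, dot (inj1 x) (inj2 y) = 0 &
      forall s, exists x y, s = inj1 x + inj2 y].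

(* A co-extension of [T] of the form [V = M (+) U] on [K = K1 (+) K2], where
   [M] is the direct sum of [kappa] copies of the coordinate shift [Mz] and [U]
   is a spherical unitary.  The space [H] of [T] is regarded as a subspace of
   [K] through the isometry [ce_emb], and [K2] through [ce_inj2]; [ce_adj] says
   both that [H] is invariant under [V_k^*] and that [V_k^*] restricts to
   [T_k^*] on it. *)
Record coextension (H : hilbertType R) (T : 'I_d -> H -> H) := Coextension {
  ce_kappa : Type ;
  ce_DA : drury_arveson ;
  ce_Mz : 'I_d -> ce_DA -> ce_DA ;
  ce_Mz_mult : coordinate_mult ce_Mz ;
  ce_K1 : hilbertType R ;
  ce_copy : ce_kappa -> ce_DA -> ce_K1 ;
  ce_K1_sum : ampliation ce_copy ;
  ce_M : 'I_d -> ce_K1 -> ce_K1 ;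
  ce_M_bounded : bounded_tuple ce_M ;
  ce_M_sum : forall k i f, ce_M k (ce_copy i f) = ce_copy i (ce_Mz k f) ;
  ce_K2 : hilbertType R ;
  ce_U : 'I_d -> ce_K2 -> ce_K2 ;
  ce_U_spherical : spherical_unitary ce_U ;
  ce_K : hilbertType R ;
  ce_inj1 : ce_K1 -> ce_K ;
  ce_inj2 : ce_K2 -> ce_K ;
  ce_K_sum : direct_sum ce_inj1 ce_inj2 ;
  ce_V : 'I_d -> ce_K -> ce_K ;
  ce_V_sum : forall k x y, ce_V k (ce_inj1 x + ce_inj2 y) =
    ce_inj1 (ce_M k x) + ce_inj2 (ce_U k y) ;
  ce_emb : H -> ce_K ;
  ce_emb_isometry : isometry ce_emb ;
  ce_adj : forall k x, adj (ce_V k) (ce_emb x) = ce_emb (adj (T k) x)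
}.

Arguments ce_U {H T} _ _ _.
Arguments ce_inj2 {H T} _ _.
Arguments ce_V {H T} _ _ _.
Arguments ce_emb {H T} _ _.

Definition minimal (H : hilbertType R) (T : 'I_d -> H -> H)
    (X : coextension T) :=
  forall N : csubspace (ce_K X), reducing (ce_V X) N ->
    range (ce_emb X) `<=` N -> cs_set N = setT.

End Tuples.

Arguments restr_tuple {R d E} T N k x.
Arguments ce_U {R d H T} _ _ _.
Arguments ce_inj2 {R d H T} _ _.
Arguments ce_V {R d H T} _ _ _.
Arguments ce_emb {R d H T} _ _.

(* Main.v *)
Require Import Defs.
From HB Require Import structures.
From mathcomp Require Import all_boot all_order all_algebra.
From mathcomp Require Import complex.
From mathcomp Require Import all_classical all_reals all_analysis.
From mathcomp Require Import ring lra.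

(** Write [N] for the right-hand side.  Since [L = H \cap K_2] is closed, [y]
    lies in [N] exactly when [U^alpha y] lies in [L] for every [alpha]
    ([ce_coreP]): [N] is the largest [U]-invariant subspace of [L].  The theorem
    says that this subspace is the unitary part of [T].

    [H_u] is contained in [N].  Let [j] be the embedding of [H], and let
    [j h = x + y] with [h] in [H_u], [x] in [K_1] and [y] in [K_2].  Both for [T]
    on [H_u] and for [U] the squared norms of the images of a vector under the
    adjoints add up to that of the vector, and [V_k^*] restricts to [T_k^*];
    hence [\sum_k |M_k^* x|^2 = |x|^2].  The defect operator
    [I - \sum_k M_k M_k^*] is a projection, on each copy of the Drury-Arveson
    space the one onto the constants ([da_defect_rank1]), so it kills [x].  The
    same holds for all vectors obtained from [x] by applying the [M_k^*], and a
    coinvariant set killed by the defect operator is zero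
    ([da_coinvariant_eq0], [ampliation_coinvariant_eq0]): [x = 0], and
    [j h = y] is in [K_2].  On [K_2], [T_k] is the compression of [U_k], and
    comparing norms once more gives [U_k y = j (T_k h)]
    ([unitary_part_shift]).  Thus [H_u] is a [U]-invariant subspace of [L].

    [N] is contained in [H_u].  [L] is invariant under [U_k^*], and [U_k^*]
    commutes with [U_j] by Fuglede's theorem, which for spherical unitaries has
    an elementary proof ([spherical_fuglede]); hence [N] is invariant under
    [U_k^*] as well.  So [N] reduces [T], which acts on it as [U], a spherical
    unitary.  The projection of [N] to the complement of [H_u] then spans a
    subspace on which [T] is again a spherical unitary, and complete
    non-unitarity forces it to be zero ([cnu_complement_sub]). *)

Set Implicit Arguments.
Unset Strict Implicit.
Unset Printing Implicit Defensive.

Import Order.TTheory GRing.Theory Num.Theory.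
Import numFieldNormedType.Exports.

Local Open Scope classical_set_scope.
Local Open Scope ring_scope.

(** * The Riesz representation theorem *)

Section Riesz.
Context (R : realType) (E : hilbertType R).
Local Notation C := R[i].
Implicit Types (x y z : E).

Lemma conj_real (a : C) : a \is Num.real -> Num.conj a = a.
Proof. by move/CrealP. Qed.

Lemma sqr_ReC (a : C) : 0 <= a -> (complex.Re a ^+ 2)%:C%C = a ^+ 2.
Proof. by move=> a0; rewrite rmorphXn; congr (_ ^+ 2); exact/RRe_real/ger0_real. Qed.

Lemma dot_ext x y : (forall z, dot z x = dot z y) -> x = y.
Proof.
move=> xy; apply/eqP; rewrite -subr_eq0 -normr_eq0 -sqrf_eq0.
by rewrite -dot_norm dotBr xy subrr.
Qed.

Lemma dotxx_eq0 x : dot x x = 0 -> x = 0.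
Proof. by rewrite dot_norm => /eqP; rewrite expf_eq0/= normr_eq0 => /eqP. Qed.

Lemma dotxx_ge0 x : 0 <= dot x x.
Proof. by rewrite dot_norm exprn_ge0. Qed.

(** The squared norm as an element of [R] rather than of the partially ordered
    [R[i]], so that infima are available. *)
Definition sqnorm x : R := complex.Re (dot x x).

Lemma sqnormE x : dot x x = (sqnorm x)%:C%C.
Proof. by rewrite /sqnorm RRe_real// ger0_real// dotxx_ge0. Qed.

Lemma sqnorm_ge0 x : 0 <= sqnorm x.
Proof. by rewrite -ler0c -sqnormE dotxx_ge0. Qed.

Lemma parallelogram x y :
  sqnorm (x - y) + sqnorm (x + y) = sqnorm x *+ 2 + sqnorm y *+ 2.
Proof.
apply: complexI; rewrite !mulr2n !rmorphD/= -!sqnormE.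
by rewrite !(dotDl, dotNl, dotDr, dotNr); ring.
Qed.

(** Subtracting the projection onto the line through [y] decreases the squared
    norm by [|<x, y>|^2 / |y|^2]: a vector of almost minimal norm in an affine
    subspace is almost orthogonal to its directions. *)
Lemma dot_sub_projE x y : y != 0 ->
  dot (x - (dot x y / `|y| ^+ 2) *: y) (x - (dot x y / `|y| ^+ 2) *: y) =
  `|x| ^+ 2 - `|dot x y| ^+ 2 / `|y| ^+ 2.
Proof.
move=> y0; set a := dot x y / `|y| ^+ 2.
have ca : Num.conj a = Num.conj (dot x y) / `|y| ^+ 2.
  rewrite /a rmorphM fmorphV rmorphXn/=; congr (_ / _ ^+ _).
  by apply: CrealP; exact: normr_real.
rewrite !dotBl !dotBr !dotZl !dotZr !dot_norm (dot_conj x y) ca /a.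
rewrite normCK.
have y2 : `|y| ^+ 2 != 0 by rewrite expf_neq0// normr_eq0.
exact: cauchy_schwarz_identity.
Qed.

(** On the hyperplane [f = 1] there is a vector [z] of minimal norm: by the
    parallelogram law the sets of almost minimizing vectors form a Cauchy filter.
    Minimality makes [z] orthogonal to the kernel of [f], so [f] is the inner
    product with a multiple of [z]. *)
Lemma riesz (f : E -> C) :
  (forall (a : C) x y, f (a *: x + y) = a * f x + f y) ->
  continuous (f : E -> C^o) -> exists z, forall x, f x = dot x z.
Proof.
move=> flin fcont.
have f0 : f 0 = 0 by apply: (addIr (f 0)); rewrite -{1}(mul1r (f 0)) -flin scale1r !add0r.
have fZ a x : f (a *: x) = a * f x by rewrite -(addr0 (a *: x)) flin f0 addr0.
have fD x y : f (x + y) = f x + f y by rewrite -{1}(scale1r x) flin mul1r.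
have [fz|/existsNP[x0 /eqP fx0]] := pselect (forall x, f x = 0).
  by exists 0 => x; rewrite fz dot0r.
pose A := [set x | f x = 1].
have A1 : A ((f x0)^-1 *: x0) by rewrite /A/= fZ mulVf.
have infA : has_inf (sqnorm @` A).
  split; first by exists (sqnorm ((f x0)^-1 *: x0)); exists ((f x0)^-1 *: x0).
  by exists 0 => _ [x _ <-]; exact: sqnorm_ge0.
pose m := inf (sqnorm @` A).
have mle x : A x -> m <= sqnorm x.
  by move=> Ax; apply: (ge_inf infA.2); exists x.
(* Almost minimizing vectors of the hyperplane, which generate the filter. *)
pose Ae (e : R) := [set x | A x /\ sqnorm x < m + e].
pose F := filter_from [set e : R | 0 < e] Ae.
have FF : ProperFilter F.
  apply: filter_from_proper; last first.
    move=> e /= e0; have [_ [x Ax <-] xe] := inf_adherent e0 infA.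
    by exists x.
  apply: filter_from_filter; first by exists 1 => /=.
  move=> e1 e2 /= e10 e20; exists (Num.min e1 e2); first by rewrite lt_min e10 e20.
  move=> x [Ax]; rewrite -ltrBlDl lt_min => /andP[].
  by rewrite !ltrBlDl.
have Adist (e : R) x y : Ae e x -> Ae e y -> sqnorm (x - y) < e *+ 4.
  move=> [Ax xe] [Ay ye].
  have : m <= sqnorm (2^-1 *: (x + y)).
    (* The midpoint of two vectors of the hyperplane lies on it. *)
    by apply: mle; rewrite /A/= fZ fD Ax Ay mulVf// pnatr_eq0.
  have -> : sqnorm (2^-1 *: (x + y)) = 4^-1 * sqnorm (x + y).
    apply: complexI; rewrite rmorphM/= -!sqnormE dotZl dotZr mulrA.
    congr (_ * _); rewrite [Num.conj _]conj_real ?realV ?realn//.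
    by rewrite -invfM -natrM fmorphV rmorph_nat.
  have := parallelogram x y; lra.
have : cauchy F.
  apply/cauchy_exP => eps eps0.
  have epsE : eps = (complex.Re eps)%:C%C by rewrite RRe_real// gtr0_real.
  have re0 : 0 < complex.Re eps by rewrite -ltcR -epsE.
  have e0 : 0 < complex.Re eps ^+ 2 / 4 by rewrite divr_gt0// exprn_gt0.
  have [x Ax] : Ae (complex.Re eps ^+ 2 / 4) !=set0.
    by have [_ [x Ax <-] xe] := inf_adherent e0 infA; exists x.
  exists x, (complex.Re eps ^+ 2 / 4) => //= y Ay.
  rewrite -ball_normE/=.
  have := Adist _ _ _ Ax Ay.
  rewrite (_ : _ *+ 4 = complex.Re eps ^+ 2); last by field.
  rewrite -ltcR -sqnormE dot_norm sqr_ReC ?ltW//.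
  by rewrite ltr_pXn2r// nnegrE// ltW.
move=> /cauchy_cvg /cvg_ex[/= z Fz].
have Az : f z = 1.
  have c1 : (f : E -> C^o) @ F --> (f z : C^o).
    by apply: (@continuous_cvg _ _ _ F _ id (f : E -> C^o) z);
      [exact: fcont|exact: Fz].
  have c2 : (f : E -> C^o) @ F --> (1 : C^o).
    apply: cvg_near_cst; exists 1 => //= x [Ax _]; exact: Ax.
  exact: (cvg_unique _ c1 c2).
have zker v : f v = 0 -> dot v z = 0.
  move=> fv; have [->|v0] := eqVneq v 0; first by rewrite dot0l.
  suff zv : dot z v = 0 by rewrite dot_conj zv rmorph0.
  have c1 : (fun x => dot x v : C^o) @ F --> (dot z v : C^o).
    by apply: (@continuous_cvg _ _ _ F _ id (fun x => dot x v : C^o) z);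
      [exact: continuous_dotl|exact: Fz].
  have c2 : (fun x => dot x v : C^o) @ F --> (0 : C^o).
    apply/cvgr0Pnorm_lt => eps eps0.
    have epsE : eps = (complex.Re eps)%:C%C by rewrite RRe_real// gtr0_real.
    have re0 : 0 < complex.Re eps by rewrite -ltcR -epsE.
    have sv0 : 0 < sqnorm v.
      by rewrite -ltcR -sqnormE dot_norm exprn_gt0// normr_gt0.
    have e0 : 0 < complex.Re eps ^+ 2 / sqnorm v.
      by rewrite divr_gt0// exprn_gt0.
    exists (complex.Re eps ^+ 2 / sqnorm v) => //= x [Ax xe].
    have : m <= sqnorm (x - (dot x v / `|v| ^+ 2) *: v).
      apply: mle; rewrite /A/= -scaleNr addrC flin fv mulr0 add0r; exact: Ax.
    rewrite -lecR -sqnormE dot_sub_projE// -!dot_norm !sqnormE.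
    have -> : `|dot x v| ^+ 2 = (complex.Re `|dot x v| ^+ 2)%:C%C.
      by rewrite sqr_ReC.
    rewrite -fmorphV -rmorphM -rmorphB lecR => h.
    have : complex.Re `|dot x v| ^+ 2 / sqnorm v < complex.Re eps ^+ 2 / sqnorm v.
      by lra.
    rewrite ltr_pM2r ?invr_gt0// -ltcR !sqr_ReC// ?ltW//.
    by rewrite ltr_pXn2r// nnegrE// ltW.
  exact: (cvg_unique _ c1 c2).
have z0 : z != 0 by apply: contra_eq_neq Az => ->; rewrite f0 eq_sym oner_eq0.
exists ((`|z| ^- 2) *: z) => x.
have : dot (x - f x *: z) z = 0.
  by apply: zker; rewrite -scaleNr addrC flin Az; ring.
rewrite dotBl dotZl dot_norm => /eqP; rewrite subr_eq0 => /eqP xz.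
have z2 : `|z| ^+ 2 != 0 by rewrite expf_neq0// normr_eq0.
rewrite dotZr xz [Num.conj _]conj_real ?realV ?realX ?normr_real//.
by rewrite mulrCA mulVf// mulr1.
Qed.

End Riesz.

(** * Adjoints, isometries and orthogonal complements *)

Section LinearMaps.
Context (R : realType) (E F : hilbertType R) (A : E -> F).
Context (Alin : linear A).

Let Af : {linear E -> F} := HB.pack A (GRing.isLinear.Build R[i] E F *:%R A Alin).

Lemma linmap0 : A 0 = 0. Proof. exact: (linear0 Af). Qed.
Lemma linmapB x y : A (x - y) = A x - A y. Proof. exact: (linearB Af). Qed.
Lemma linmapZ a x : A (a *: x) = a *: A x. Proof. exact: (linearZZ Af). Qed.
Lemma linmap_sum I (r : seq I) (P : pred I) (f : I -> E) :
  A (\sum_(i <- r | P i) f i) = \sum_(i <- r | P i) A (f i).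
Proof. exact: (linear_sum Af). Qed.

End LinearMaps.

Section DotSums.
Context (R : realType) (E : hilbertType R).

Lemma dot_suml I (r : seq I) (P : pred I) (f : I -> E) x :
  dot (\sum_(i <- r | P i) f i) x = \sum_(i <- r | P i) dot (f i) x.
Proof.
apply: (big_morph (fun y => dot y x)); [move=> y z; exact: dotDl|exact: dot0l].
Qed.

Lemma dot_sumr I (r : seq I) (P : pred I) (f : I -> E) x :
  dot x (\sum_(i <- r | P i) f i) = \sum_(i <- r | P i) dot x (f i).
Proof.
apply: (big_morph (fun y => dot x y)); [move=> y z; exact: dotDr|exact: dot0r].
Qed.

Lemma sum_dotxx_eq0 (I : finType) (f : I -> E) :
  \sum_i dot (f i) (f i) = 0 -> forall i, f i = 0.
Proof.
move=> s0 i; apply: dotxx_eq0.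
have := @psumr_eq0P _ _ xpredT (fun i => dot (f i) (f i)) _ s0 i.
by apply=> // j _; exact: dotxx_ge0.
Qed.

Lemma dot_orth_sym (x y : E) : dot x y = 0 -> dot y x = 0.
Proof. by move=> xy; rewrite dot_conj xy rmorph0. Qed.

End DotSums.

Section Adjoint.
Context (R : realType) (E F : hilbertType R).

(** The adjoint of a map between two different spaces; on a single space it is
    [adj] by definition. *)
Definition hom_adj (A : E -> F) (y : F) : E :=
  xget 0 [set z | forall x, dot (A x) y = dot x z].

Lemma dot_hom_adj (A : E -> F) : linear A -> continuous A ->
  forall x y, dot (A x) y = dot x (hom_adj A y).
Proof.
move=> Alin Acont x y; rewrite /hom_adj; move: x.
apply: (@xgetPex _ 0 [set z | forall x, dot (A x) y = dot x z]).
apply: (@riesz _ _ (fun x => dot (A x) y)).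
  by move=> a x x'; rewrite Alin dot_linearl.
move=> x; apply: (@continuous_comp _ _ _ A (fun z => dot z y : R[i]^o)).
  exact: Acont.
exact: continuous_dotl.
Qed.

Lemma hom_adj_uniq (A : E -> F) y z :
  (forall x, dot (A x) y = dot x z) -> hom_adj A y = z.
Proof.
move=> Az; apply: dot_ext => x; rewrite -Az; move: x.
by rewrite /hom_adj; case: xgetP => [u _ h x|/(_ z)]; [rewrite h|case].
Qed.

Lemma isometry_normE (j : E -> F) x : Defs.isometry j -> `|j x| = `|x|.
Proof.
move=> [_ jd]; apply/eqP; rewrite -(eqrXn2 (n := 2))// -!dot_norm jd.
exact: eqxx.
Qed.

Lemma isometry_continuous (j : E -> F) : Defs.isometry j -> continuous j.
Proof.
move=> jI x; apply/cvgrPdist_lt => e e0.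
have : \forall y \near x, `|x - y| < e by exact: cvgr_dist_lt.
by apply: filterS => y; rewrite -(linmapB jI.1) isometry_normE.
Qed.

Lemma isometry_dotr (j : E -> F) : Defs.isometry j ->
  forall x y, dot (j x) y = dot x (hom_adj j y).
Proof. by move=> jI; apply: dot_hom_adj; [exact: jI.1|exact: isometry_continuous]. Qed.

Lemma isometry_inj (j : E -> F) : Defs.isometry j -> injective j.
Proof.
move=> jI x y xy; apply: dot_ext => z.
by rewrite -!jI.2 xy.
Qed.

Lemma isometry_adjK (j : E -> F) : Defs.isometry j -> cancel j (hom_adj j).
Proof. by move=> jI x; apply: hom_adj_uniq => y; rewrite jI.2. Qed.

(** The range of an isometry is closed, and [j j^*] is the projection onto it. *)
Lemma isometry_biorth (j : E -> F) : Defs.isometry j ->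
  orthc (orthc (range j)) `<=` range j.
Proof.
move=> jI x xj; exists (hom_adj j x) => //.
have pj : orthc (range j) (x - j (hom_adj j x)).
  move=> _ [y _ <-]; apply: dot_orth_sym.
  by rewrite dotBr jI.2 isometry_dotr// subrr.
apply/esym/eqP; rewrite -subr_eq0; apply/eqP/dotxx_eq0.
rewrite dotBl xj// (_ : dot (j _) _ = 0) ?subr0//.
by apply: dot_orth_sym; apply: pj; exists (hom_adj j x).
Qed.

End Adjoint.

Lemma isometry_reflect_continuous (R : realType) (E F G : hilbertType R)
  (j : F -> G) (A : E -> F) : Defs.isometry j -> continuous (j \o A) -> continuous A.
Proof.
move=> jI jAc x; apply/cvgrPdist_lt => e e0.
have /cvgrPdist_lt/(_ e e0) := jAc x.
apply: filterS => y /=.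
by rewrite -(linmapB jI.1) isometry_normE.
Qed.

Section BoundedOp.
Context (R : realType) (E : hilbertType R).
Implicit Types (A : E -> E).

Lemma dot_adjr A x y : bounded_op A -> dot (A x) y = dot x (adj A y).
Proof. by move=> [Al Ac]; exact: dot_hom_adj. Qed.

Lemma dot_adjl A x y : bounded_op A -> dot (adj A x) y = dot x (A y).
Proof. by move=> Ab; rewrite dot_conj -dot_adjr// -dot_conj. Qed.

Lemma adj_linear A : bounded_op A -> linear (adj A).
Proof.
move=> Ab a x y; apply: hom_adj_uniq => z.
by rewrite !(dotDr, dotZr) -!dot_adjr.
Qed.

Lemma orthcS (A B : set E) : A `<=` B -> orthc B `<=` orthc A.
Proof. by move=> AB x Bx y /AB; exact: Bx. Qed.

Lemma sub_biorth (A : set E) : A `<=` orthc (orthc A).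
Proof. by move=> x Ax y Ay; apply: dot_orth_sym; exact: Ay. Qed.

Lemma triorth (A : set E) : orthc (orthc (orthc A)) = orthc A.
Proof. by apply/seteqP; split; [exact/orthcS/sub_biorth|exact: sub_biorth]. Qed.

(** Orthogonality to a vector is a closed linear condition. *)
Lemma orthc_cspan (A : set E) : orthc (cspan A) = orthc A.
Proof.
have subA : A `<=` cspan A.
  move=> x Ax; apply: subset_closure.
  by exists 1%N, (fun=> 1), (fun=> x); split=> //; rewrite big_ord1 scale1r.
apply/seteqP; split; first exact: orthcS.
move=> x xA y yA; apply: dot_orth_sym; move: y yA.
suff : cspan A `<=` orthc [set x] by move=> h y /h; apply.
rewrite ((closure_id _).1 (@orthc_closed _ _ [set x])).
apply: closure_subset => _ [n [a [v [Av ->]]]] _ ->.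
rewrite dot_suml big1// => i _.
by rewrite dotZl (dot_orth_sym (xA _ (Av i))) mulr0.
Qed.

End BoundedOp.

(** * Restriction of a tuple to a reducing subspace *)

Section Restriction.
Context (R : realType) (d : nat) (E : hilbertType R) (T : 'I_d -> E -> E).
Context (N : csubspace E).

Lemma val_isometry : Defs.isometry (\val : subhilb N -> E).
Proof. by split=> //; move=> a x y. Qed.

Lemma range_val : range (\val : subhilb N -> E) = N.
Proof.
apply/seteqP; split=> [_ [x _ <-]|x Nx]; first exact: subhilbP.
by exists (SubHilb (introT (cs_predP _ _) Nx)).
Qed.

Lemma csubspace_biorth : orthc (orthc N) `<=` N.
Proof. by rewrite -range_val; exact/isometry_biorth/val_isometry. Qed.

Context (NT : Defs.invariant T N).

Lemma val_restr k x : \val (restr_tuple T N k x) = T k (\val x).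
Proof. by rewrite /restr_tuple insubdK//; apply/cs_predP/NT/subhilbP. Qed.

Context (Tb : bounded_tuple T).

Lemma restr_bounded : bounded_tuple (restr_tuple T N).
Proof.
move=> k; split.
  move=> a x y; apply: val_inj; rewrite val_restr.
  rewrite !linearP/= !val_restr; exact: (Tb k).1.
apply: (isometry_reflect_continuous val_isometry).
rewrite (_ : \val \o _ = T k \o \val); last by apply/funext => x /=; rewrite val_restr.
move=> x; apply: continuous_comp; last exact: (Tb k).2.
exact/isometry_continuous/val_isometry.
Qed.

Context (NTa : Defs.invariant (fun k => adj (T k)) N).

Lemma val_adj_restr k x : \val (adj (restr_tuple T N k) x) = adj (T k) (\val x).
Proof.
have Na : cs_set N (adj (T k) (\val x)) by apply: NTa; exact: subhilbP.
rewrite (_ : adj _ x = SubHilb (introT (cs_predP _ _) Na))//.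
by apply: hom_adj_uniq => y; rewrite [LHS]/dot/= val_restr dot_adjr.
Qed.

(** For a reducing subspace the adjoint of the restriction is the restriction of
    the adjoint, so the defining identities can be read in the ambient space. *)
Lemma spherical_restrP : commuting T ->
  spherical_unitary (restr_tuple T N) <->
  (forall x, cs_set N x -> (forall k, T k (adj (T k) x) = adj (T k) (T k x)) /\
     \sum_k T k (adj (T k) x) = x).
Proof.
move=> Tc.
have vsum (x : subhilb N) : \val (\sum_k restr_tuple T N k (adj (restr_tuple T N k) x)) =
    \sum_k T k (adj (T k) (\val x)).
  rewrite (linmap_sum val_isometry.1).
  by apply: eq_bigr => k _; rewrite val_restr val_adj_restr.
split=> [[_ _ Tn Ts] x Nx|h].
  pose x' : subhilb N := SubHilb (introT (cs_predP _ _) Nx).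
  split=> [k|].
    have := congr1 \val (Tn k x').
    by rewrite val_restr !val_adj_restr val_restr.
  by have := congr1 \val (Ts x'); rewrite vsum.
split=> [|j k x|k x|x].
- exact: restr_bounded.
- by apply: val_inj; rewrite !val_restr.
- apply: val_inj; rewrite val_restr !val_adj_restr val_restr.
  by apply: (h _ _).1; exact: subhilbP.
- by apply: val_inj; rewrite vsum; apply: (h _ _).2; exact: subhilbP.
Qed.

End Restriction.

(** * Spherical unitaries *)

Section Spherical.
Context (R : realType) (d : nat) (E : hilbertType R) (U : 'I_d -> E -> E).
Context (Us : spherical_unitary U).

Let Ub k : bounded_op (U k). Proof. by case: Us. Qed.
Let Uc : commuting U. Proof. by case: Us. Qed.
Let Un k x : U k (adj (U k) x) = adj (U k) (U k x). Proof. by case: Us. Qed.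
Let Usum x : \sum_k U k (adj (U k) x) = x. Proof. by case: Us. Qed.

Lemma spherical_dot_adj x y : \sum_k dot (adj (U k) x) (adj (U k) y) = dot x y.
Proof.
rewrite -{2}(Usum x) dot_suml; apply: eq_bigr => k _.
by rewrite (dot_adjr _ _ (Ub k)).
Qed.

(** The column operator of a spherical unitary is an isometry, since the [U_k]
    are normal. *)
Lemma spherical_dot x y : \sum_k dot (U k x) (U k y) = dot x y.
Proof.
rewrite -{2}(Usum y) dot_sumr; apply: eq_bigr => k _.
by rewrite (dot_adjr _ _ (Ub k)) Un.
Qed.

Lemma normal_dot k x : dot (U k x) (U k x) = dot (adj (U k) x) (adj (U k) x).
Proof. by rewrite (dot_adjr _ _ (Ub k)) -Un (dot_adjl _ _ (Ub k)). Qed.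

(** The map [Phi(A) = \sum_i U_i^* A U_i] is unital and completely positive.  It
    fixes [U_j], which commutes with all [U_i], and hence [U_j^*]; it also fixes
    [U_j^* U_j = U_j U_j^*], because [|U_j U_i x| = |U_i U_j x|] and the column
    of the [U_i] is isometric.  So [U_j^*] is in the multiplicative domain of
    [Phi], which means that the commutators [c i] below, whose squared norms
    add up to the defect of multiplicativity, vanish. *)
Lemma spherical_fuglede j k x : adj (U j) (U k x) = U k (adj (U j) x).
Proof.
pose c i := adj (U j) (U i x) - U i (adj (U j) x).
suff /(_ k)/eqP : forall i, c i = 0 by rewrite subr_eq0 => /eqP.
apply: sum_dotxx_eq0.
pose z := U j (adj (U j) x).
have cE i : dot (c i) (c i) = dot (U i (U j x)) (U i (U j x)) -
    dot (U i x) (U i z) - Num.conj (dot (U i x) (U i z)) +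
    dot (U i (adj (U j) x)) (U i (adj (U j) x)).
  have b : dot (adj (U j) (U i x)) (U i (adj (U j) x)) = dot (U i x) (U i z).
    by rewrite (dot_adjl _ _ (Ub j)) Uc.
  rewrite /c dotBl !dotBr -normal_dot Uc b (dot_conj (adj (U j) (U i x))) b.
  by rewrite opprB addrA addrAC.
rewrite (eq_bigr _ (fun i _ => cE i)) big_split/= !sumrB.
have zE : dot x z = dot (adj (U j) x) (adj (U j) x) by rewrite /z (dot_adjl _ _ (Ub j)).
rewrite -rmorph_sum/= !spherical_dot normal_dot zE.
by rewrite conj_real ?ger0_real ?dotxx_ge0// subrr sub0r addNr.
Qed.

End Spherical.

(** * Coinvariant sets in the Drury-Arveson space *)

Lemma cauchy_schwarz_sum (R : realType) (d : nat) (a b : 'I_d -> R[i]) :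
  `|\sum_k a k * b k| ^+ 2 <= (\sum_k `|a k| ^+ 2) * (\sum_k `|b k| ^+ 2).
Proof.
pose u : 'rV[R[i]]_d := \row_k a k; pose v : 'rV[R[i]]_d := \row_k Num.conj (b k).
have dE (x y : 'rV[R[i]]_d) : dotmx x y = \sum_k x 0 k * Num.conj (y 0 k).
  by rewrite dotmxE mxE; apply: eq_bigr => k _; rewrite !mxE.
have : `|dotmx u v| ^+ 2 <= dotmx u u * dotmx v v.
  exact: (CauchySchwarz (@dotmx _ d) u v).1.
rewrite !dE; congr (`|_| ^+ 2 <= _ * _); apply: eq_bigr => k _; rewrite !mxE.
- by rewrite conjCK.
- by rewrite normCK.
- by rewrite conjCK normCK mulrC.
Qed.

Section DruryArveson.
Context (R : realType) (d : nat) (F : drury_arveson R d).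
Context (M : 'I_d -> F -> F).
Context (Mmult : coordinate_mult M).
Let Mb k : bounded_op (M k). Proof. exact: Mmult.1. Qed.

Lemma cdot_ge0 (z : 'rV[R[i]]_d) : 0 <= cdot z z.
Proof. by apply: sumr_ge0 => k _; rewrite -normCK exprn_ge0. Qed.

Lemma cball0 : cball (0 : 'rV[R[i]]_d).
Proof. by rewrite /cball/= /cdot big1// => k _; rewrite mxE mul0r. Qed.

Lemma cdot_conj (z w : 'rV[R[i]]_d) : cdot w z = Num.conj (cdot z w).
Proof.
rewrite /cdot rmorph_sum; apply: eq_bigr => k _.
by rewrite rmorphM/= conjCK mulrC.
Qed.

(** If [<z, w> = 1] with [z] and [w] in the ball, then
    [|z - w|^2 = |z|^2 + |w|^2 - 2 < 0]. *)
Lemma cball_neq1 (z w : 'rV[R[i]]_d) : cball z -> cball w -> 1 - cdot z w != 0.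
Proof.
move=> zb wb; rewrite subr_eq0; apply/eqP => zw1.
have : 0 <= cdot (z - w) (z - w) by exact: cdot_ge0.
have -> : cdot (z - w) (z - w) = cdot z z - cdot z w - cdot w z + cdot w w.
  rewrite /cdot -!sumrB -big_split/=; apply: eq_bigr => k _.
  by rewrite !mxE rmorphB/=; ring.
rewrite (cdot_conj z w) -zw1 rmorph1 => h.
have lt2 : cdot z z + cdot w w < 1 + 1 by exact: ltrD.
suff : 1 + 1 <= cdot z z + cdot w w by move=> /(lt_le_trans lt2); rewrite ltxx.
rewrite -subr_ge0; apply: le_trans h _; rewrite le_eqVlt; apply/orP; left.
by apply/eqP; ring.
Qed.

Lemma da_evalD (f g : F) z : cball z -> da_eval (f + g) z = da_eval f z + da_eval g z.
Proof. by move=> zb; rewrite -{1}(scale1r f) da_eval_linear// mul1r. Qed.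

Lemma da_eval0 z : cball z -> da_eval (0 : F) z = 0.
Proof. by move=> zb; apply: (addrI (da_eval (0 : F) z)); rewrite -da_evalD// !addr0. Qed.

Lemma da_evalZ (a : R[i]) (f : F) z : cball z -> da_eval (a *: f) z = a * da_eval f z.
Proof. by move=> zb; rewrite -(addr0 (a *: f)) da_eval_linear// da_eval0// addr0. Qed.

Lemma da_eval_sum z (f : 'I_d -> F) : cball z ->
  da_eval (\sum_k f k) z = \sum_k da_eval (f k) z.
Proof.
move=> zb; apply: (big_morph (fun g : F => da_eval g z)); last exact: da_eval0.
by move=> g h; exact: da_evalD.
Qed.

(** As [M_k^* k_w] is [w_k^*] times the kernel function [k_w], one has
    [\sum_k M_k M_k^* k_w = <z, w> / (1 - <z, w>) = k_w - 1], and pairing [f]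
    with this identity gives [\sum_k M_k M_k^* f = f - f(0)]. *)
Lemma da_defect_rank1 : exists one : F,
  (forall z, cball z -> da_eval one z = 1) /\
  forall f, f - \sum_k M k (adj (M k) f) = da_eval f 0 *: one.
Proof.
have [one [one1 onedot]] := da_kernel F cball0.
have oneE z : cball z -> da_eval one z = 1.
  move=> zb; rewrite one1// /cdot big1 ?subr0 ?invr1// => k _.
  by rewrite mxE rmorph0 mulr0.
exists one; split=> // f.
apply: da_eval_inj => w wb.
have [kw [kwE kwdot]] := da_kernel F wb.
have adjkw k : adj (M k) kw = Num.conj (w 0 k) *: kw.
  apply: hom_adj_uniq => g.
  by rewrite -kwdot Mmult.2// kwdot dotZr conjCK.
have defkw : \sum_k M k (adj (M k) kw) = kw - one.
  apply: da_eval_inj => z zb.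
  rewrite da_eval_sum// -scaleN1r da_evalD// da_evalZ// oneE// kwE//.
  rewrite (eq_bigr (fun k => (z 0 k * Num.conj (w 0 k)) * (1 - cdot z w)^-1)); last first.
    move=> k _; rewrite adjkw (linmapZ (Mb k).1) da_evalZ// Mmult.2// kwE//; ring.
  rewrite -mulr_suml -/(cdot z w).
  have := cball_neq1 zb wb; set c := cdot z w => c1.
  by field.
have e : da_eval (\sum_k M k (adj (M k) f)) w = da_eval f w - da_eval f 0.
  rewrite kwdot dot_suml.
  transitivity (dot f (\sum_k M k (adj (M k) kw))).
    by rewrite dot_sumr; apply: eq_bigr => k _; rewrite (dot_adjr _ _ (Mb k)) (dot_adjl _ _ (Mb k)).
  by rewrite defkw dotBr -kwdot -onedot.
rewrite -scaleN1r da_evalD// !da_evalZ// e oneE//; ring.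
Qed.

(** If [f = \sum_k M_k M_k^* f] then [f(w) = \sum_k w_k (M_k^* f)(w)], while the
    squared norms of the [M_k^* f] add up to that of [f].  Hence any bound
    [|f(w)|^2 <= C |f|^2] valid on [S] improves to [|w|^2 C]; since evaluation at
    [w] is bounded and [|w| < 1], all values vanish. *)
Lemma da_coinvariant_eq0 (S : set F) :
  (forall k f, S f -> S (adj (M k) f)) ->
  (forall f, S f -> \sum_k M k (adj (M k) f) = f) ->
  forall f, S f -> f = 0.
Proof.
move=> Sinv Sdef f Sf; apply: da_eval_inj => w wb; rewrite da_eval0//.
have [kw [_ kwdot]] := da_kernel F wb.
(* The bound after [n] improvements. *)
have bnd n g : S g ->
    `|da_eval g w| ^+ 2 <= cdot w w ^+ n * (`|kw| ^+ 2 * dot g g).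
  elim: n g => [|n IH] g Sg.
    by rewrite mul1r kwdot dot_norm -exprMn mulrC ler_sqr ?nnegrE ?mulr_ge0// cauchy_schwarz.
  rewrite -{1}(Sdef g Sg) da_eval_sum//.
  rewrite (eq_bigr (fun k => w 0 k * da_eval (adj (M k) g) w)); last first.
    by move=> k _; rewrite Mmult.2.
  apply: le_trans (cauchy_schwarz_sum _ _) _.
  have -> : \sum_k `|w 0 k| ^+ 2 = cdot w w by apply: eq_bigr => k _; rewrite normCK.
  rewrite exprS -mulrA ler_wpM2l ?cdot_ge0//.
  have -> : dot g g = \sum_k dot (adj (M k) g) (adj (M k) g).
    rewrite -{1}(Sdef g Sg) dot_suml; apply: eq_bigr => k _; exact: (dot_adjr _ _ (Mb k)).
  rewrite !mulr_sumr; apply: ler_sum => k _.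
  exact/IH/Sinv.
apply/eqP; rewrite -normr_eq0 -sqrf_eq0 eq_le exprn_ge0// andbT.
set a := `|_| ^+ 2.
have realE (c : R[i]) : 0 <= c -> c = (complex.Re c)%:C%C.
  by move=> c0; rewrite RRe_real// ger0_real.
have a0 : 0 <= a by rewrite exprn_ge0.
have c0 : 0 <= `|kw| ^+ 2 * dot f f by rewrite mulr_ge0 ?exprn_ge0 ?dotxx_ge0.
rewrite (realE a)// lecR.
have r0 := cdot_ge0 w.
have r1 : `|complex.Re (cdot w w)| < 1.
  rewrite ger0_norm -?ler0c -?ltcR -?realE//; exact: wb.
apply: (cvgr_to_ge (cvg_geometric (complex.Re (`|kw| ^+ 2 * dot f f)) r1)).
apply: nearW => n; rewrite -lecR -realE//.
rewrite /geometric/= rmorphM rmorphXn/= mulrC.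
apply: le_trans (bnd n f Sf) _.
by rewrite -/a {1}(realE _ r0) {1}(realE _ c0).
Qed.

End DruryArveson.

(** * Coinvariant sets in a direct sum of copies *)

Section Ampliation.
Context (R : realType) (d : nat) (F : drury_arveson R d).
Context (M : 'I_d -> F -> F) (Mmult : coordinate_mult M).
Context (I : Type) (K : hilbertType R) (copy : I -> F -> K).
Context (Ksum : ampliation copy).
Context (MK : 'I_d -> K -> K).
Context (MKb : forall k, bounded_op (MK k)).
Context (MK_copy : forall k i f, MK k (copy i f) = copy i (M k f)).

Let Mb k : bounded_op (M k). Proof. exact: Mmult.1. Qed.
Let copyI i : Defs.isometry (copy i). Proof. by case: Ksum. Qed.

Lemma ampliation_ext x y :
  (forall i, hom_adj (copy i) x = hom_adj (copy i) y) -> x = y.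
Proof.
move=> xy; have : orthc (cspan (\bigcup_i range (copy i))) (x - y).
  rewrite orthc_cspan => _ [i _ [f _ <-]]; apply: dot_orth_sym.
  by rewrite dotBr !(isometry_dotr (copyI i)) xy subrr.
case: Ksum => _ _ -> /(_ (x - y) Logic.I)/dotxx_eq0/eqP.
by rewrite subr_eq0 => /eqP.
Qed.

Lemma ampliation_adj k i x :
  hom_adj (copy i) (adj (MK k) x) = adj (M k) (hom_adj (copy i) x).
Proof.
apply: dot_ext => z.
rewrite -(isometry_dotr (copyI i)) -(dot_adjr _ _ (MKb k)) MK_copy.
by rewrite (isometry_dotr (copyI i)) (dot_adjr _ _ (Mb k)).
Qed.

Lemma ampliation_hom_adj_copy i j f :
  hom_adj (copy j) (copy i f) = if `[< j = i >] then f else 0.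
Proof.
case: asboolP => [->|ji]; first exact: isometry_adjK.
apply: hom_adj_uniq => x; rewrite dot0r; case: Ksum => _ + _; exact.
Qed.

Lemma ampliation_adj_copy k i f :
  adj (MK k) (copy i f) = copy i (adj (M k) f).
Proof.
apply: ampliation_ext => j; rewrite ampliation_adj !ampliation_hom_adj_copy.
by case: ifP => // _; rewrite (linmap0 (adj_linear (Mb k))).
Qed.

Lemma ampliation_shift k i x : hom_adj (copy i) (MK k x) = M k (hom_adj (copy i) x).
Proof.
apply: dot_ext => z.
rewrite -(isometry_dotr (copyI i)) -(dot_adjl _ _ (MKb k)) ampliation_adj_copy.
by rewrite (isometry_dotr (copyI i)) (dot_adjl _ _ (Mb k)).
Qed.

Lemma hom_adj_copy_linear i : linear (hom_adj (copy i)).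
Proof.
move=> a x y; apply: hom_adj_uniq => z.
by rewrite !(dotDr, dotZr) !(isometry_dotr (copyI i)).
Qed.

(** The defect operator [D] of the direct sum acts on each copy as a projection,
    so it is a projection and [<D x, x> = |D x|^2].  The hypothesis therefore
    says that [D] kills [S], and this passes to the coordinates of [S] in each
    copy. *)
Lemma ampliation_coinvariant_eq0 (S : set K) :
  (forall k x, S x -> S (adj (MK k) x)) ->
  (forall x, S x -> \sum_k dot (adj (MK k) x) (adj (MK k) x) = dot x x) ->
  forall x, S x -> x = 0.
Proof.
move=> Sinv Sdef.
have [one [one1 defect]] := da_defect_rank1 Mmult.
pose D x := x - \sum_k MK k (adj (MK k) x).
have hsum i x : hom_adj (copy i) (\sum_k MK k (adj (MK k) x)) =
    \sum_k M k (adj (M k) (hom_adj (copy i) x)).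
  rewrite (linmap_sum (hom_adj_copy_linear i)); apply: eq_bigr => k _.
  by rewrite ampliation_shift ampliation_adj.
have hD i x : hom_adj (copy i) (D x) = da_eval (hom_adj (copy i) x) 0 *: one.
  by rewrite /D (linmapB (hom_adj_copy_linear i)) hsum defect.
have Dproj x : D (D x) = D x.
  apply: ampliation_ext => i; rewrite !hD da_evalZ; last exact: cball0.
  by rewrite one1 ?mulr1//; exact: cball0.
have Dself x y : dot (D x) y = dot x (D y).
  rewrite /D dotBl dotBr dot_suml dot_sumr; congr (_ - _).
  by apply: eq_bigr => k _; rewrite (dot_adjr _ _ (MKb k)) (dot_adjl _ _ (MKb k)).
have D0 x : S x -> D x = 0.
  move=> Sx; apply: dotxx_eq0; rewrite Dself Dproj /D dotBr dot_sumr.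
  apply/eqP; rewrite subr_eq0 -{1}(Sdef x Sx); apply/eqP/eq_bigr => k _.
  by rewrite (dot_adjl _ _ (MKb k)).
move=> x Sx; apply: ampliation_ext => i.
rewrite (linmap0 (hom_adj_copy_linear i)).
apply: (da_coinvariant_eq0 Mmult (S := hom_adj (copy i) @` S)); last by exists x.
  by move=> k _ [y Sy <-]; exists (adj (MK k) y); [exact: Sinv|exact: ampliation_adj].
move=> _ [y Sy <-]; rewrite -hsum; congr hom_adj.
by have /eqP := D0 y Sy; rewrite subr_eq0 => /eqP.
Qed.

End Ampliation.

Section Biorth.
Context (R : realType) (d : nat) (E : hilbertType R) (T : 'I_d -> E -> E).
Context (Tb : forall k, bounded_op (T k)).

(** The range of [D] is orthogonal to its kernel.  This extends operator
    identities from a set to the closed subspace that it spans without a limit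
    argument. *)
Lemma selfadjoint_eq0_biorth (A : set E) (D : E -> E) :
  (forall x y, dot (D x) y = dot x (D y)) -> (forall x, A x -> D x = 0) ->
  forall x, orthc (orthc A) x -> D x = 0.
Proof.
move=> Dself DA x xA; apply: dotxx_eq0; rewrite Dself; apply: xA => y Ay.
by rewrite Dself (DA y)// dot0r.
Qed.

Lemma reducing_orthc (A : set E) : reducing T A -> reducing T (orthc A).
Proof.
move=> [TA TaA]; split=> k x xA y Ay.
  by rewrite (dot_adjr _ _ (Tb k)); apply/xA/TaA.
by rewrite (dot_adjl _ _ (Tb k)); apply/xA/TA.
Qed.

Lemma spherical_unitary_biorth (A : set E) : commuting T -> reducing T A ->
  (forall k x, A x -> T k (adj (T k) x) = adj (T k) (T k x)) ->
  (forall x, A x -> \sum_k T k (adj (T k) x) = x) ->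
  spherical_unitary (restr_tuple T (complement (orthc A))).
Proof.
move=> Tc redA An Asum.
have [inv inva] := reducing_orthc (reducing_orthc redA).
apply/(@spherical_restrP _ _ _ _ (complement (orthc A)) inv Tb inva Tc) => x xA; split=> [k|].
  apply/eqP; rewrite -subr_eq0; apply/eqP.
  apply: (@selfadjoint_eq0_biorth A (fun y => T k (adj (T k) y) - adj (T k) (T k y))) xA.
  - move=> y z; rewrite dotBl dotBr.
    by rewrite !(dot_adjr _ _ (Tb k)) !(dot_adjl _ _ (Tb k)) (dot_adjr _ _ (Tb k)).
  - by move=> y Ay; rewrite An// subrr.
apply/eqP; rewrite -subr_eq0; apply/eqP.
apply: (@selfadjoint_eq0_biorth A (fun y => \sum_k T k (adj (T k) y) - y)) xA.
- move=> y z; rewrite dotBl dotBr dot_suml dot_sumr; congr (_ - _).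
  by apply: eq_bigr => k _; rewrite (dot_adjr _ _ (Tb k)) (dot_adjl _ _ (Tb k)).
- by move=> y Ay; rewrite Asum// subrr.
Qed.

End Biorth.

(** * Monomials in a commuting tuple *)

Section Opow.
Context (R : realType) (d : nat) (E : hilbertType R) (U : 'I_d -> E -> E).
Context (Uc : commuting U).
Context (Ub : forall k, bounded_op (U k)).

Lemma opow_ind (P : (E -> E) -> Prop) alpha :
  P id -> (forall A B, P A -> P B -> P (A \o B)) -> (forall k, P (U k)) ->
  P (opow U alpha).
Proof.
move=> Pid Pcomp PU; rewrite /opow; apply: big_ind => // k _.
elim: (alpha k) => // n IH.
exact: (Pcomp (U k) (iter n (U k)) (PU k) IH).
Qed.

Lemma opow_bounded alpha : bounded_op (opow U alpha).
Proof.
apply: opow_ind => //; first by split=> // x; exact: cvg_id.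
move=> A B [Al Ac] [Bl Bc]; split; first by move=> a x y; rewrite /= Bl Al.
by move=> x; apply: continuous_comp; [exact: Bc|exact: Ac].
Qed.

Lemma opow_commute alpha (B : E -> E) : (forall k x, U k (B x) = B (U k x)) ->
  forall x, opow U alpha (B x) = B (opow U alpha x).
Proof.
move=> UB; apply: (@opow_ind (fun A => forall x, A (B x) = B (A x))) => //.
by move=> A A' AB A'B x; rewrite /= A'B AB.
Qed.

Lemma opow0 x : opow U (fun=> 0%N) x = x.
Proof.
rewrite /opow; apply: (big_ind (fun A : E -> E => A x = x)) => // A B /= Ax Bx.
by rewrite Bx Ax.
Qed.

(** The factors of a monomial are ordered; commutation moves the extra [U_j] from
    its place among them to the innermost position. *)
Lemma opowS alpha j x :
  opow U (fun k => alpha k + (k == j))%N x = opow U alpha (U j x).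
Proof.
rewrite /opow; have : uniq (index_enum 'I_d) by exact: index_enum_uniq.
have jin : j \in index_enum 'I_d by exact: mem_index_enum.
rewrite (_ : U j x = if j \in index_enum 'I_d then U j x else x); last by rewrite jin.
elim: (index_enum _) {jin} => [|a r IH]; first by rewrite !big_nil.
rewrite cons_uniq !big_cons inE /= => /andP[ar ur].
rewrite IH// (eq_sym j a); case: eqVneq ar => [->|aj] /= jr; last by rewrite addn0.
rewrite (negbTE jr) addn1 iterSr; congr (iter _ _ _).
move: {IH} x; apply: (big_ind (fun A => forall x, U j (A x) = A (U j x))) => //.
  by move=> A B jA jB x /=; rewrite jA jB.
by move=> k _; elim: (alpha k) => //= n jn x; rewrite Uc jn.
Qed.

End Opow.

(** * The co-extension *)

Section Coextension.
Context (R : realType) (d : nat) (H : hilbertType R) (T : 'I_d -> H -> H).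
Context (Tb : forall k, bounded_op (T k)).
Context (X : coextension T).

Notation j := (ce_emb X).
Notation i2 := (ce_inj2 X).
Notation U := (ce_U X).
Notation V := (ce_V X).
Let i1 := @ce_inj1 R d H T X.
Let M := @ce_M R d H T X.

Let i1I : Defs.isometry i1. Proof. by have [] := @ce_K_sum R d H T X. Qed.
Let i2I : Defs.isometry i2. Proof. by have [] := @ce_K_sum R d H T X. Qed.
Let jI : Defs.isometry j. Proof. exact: ce_emb_isometry. Qed.
Let i12 x y : dot (i1 x) (i2 y) = 0. Proof. by have [_ _] := @ce_K_sum R d H T X. Qed.
Let Us : spherical_unitary U. Proof. exact: ce_U_spherical. Qed.
Let Ub k : bounded_op (U k). Proof. by case: Us. Qed.
Let Uc : commuting U. Proof. by case: Us. Qed.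
Let Mb k : bounded_op (M k). Proof. exact: ce_M_bounded. Qed.

Lemma ce_decomp s : exists x y, s = i1 x + i2 y.
Proof. by have [_ _ _] := @ce_K_sum R d H T X. Qed.

Lemma ce_dot a b x y : dot (i1 a + i2 b) (i1 x + i2 y) = dot a x + dot b y.
Proof.
rewrite dotDl !dotDr i12 (dot_orth_sym (i12 x b)) addr0 add0r.
by rewrite i1I.2 i2I.2.
Qed.

Lemma ce_adjV k x y :
  adj (V k) (i1 x + i2 y) = i1 (adj (M k) x) + i2 (adj (U k) y).
Proof.
apply: hom_adj_uniq => s; have [a [b ->]] := ce_decomp s.
by rewrite ce_V_sum !ce_dot (dot_adjr _ _ (Mb k)) (dot_adjr _ _ (Ub k)).
Qed.

Lemma ce_inj2E y : i2 y = i1 0 + i2 y.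
Proof. by rewrite (linmap0 i1I.1) add0r. Qed.

Lemma ce_dot_K2 y a b : dot (i2 y) (i1 a + i2 b) = dot y b.
Proof. by rewrite ce_inj2E ce_dot dot0l add0r. Qed.

Lemma ce_adjV_K2 k y : adj (V k) (i2 y) = i2 (adj (U k) y).
Proof.
by rewrite ce_inj2E ce_adjV (linmap0 (adj_linear (Mb k))) -ce_inj2E.
Qed.

Lemma ce_adj_K2 k h y : j h = i2 y -> j (adj (T k) h) = i2 (adj (U k) y).
Proof. by move=> hy; rewrite -ce_adj hy ce_adjV_K2. Qed.

(** On [H \cap K_2], where [V_k] acts as [U_k], [T_k] is the compression of [U_k]
    to [H], because [T_k^*] is a restriction of [V_k^*]. *)
Lemma ce_compress k h y g : j h = i2 y ->
  dot (i2 (U k y)) (j g) = dot (T k h) g.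
Proof.
move=> hy; rewrite (dot_adjr _ _ (Tb k)) -jI.2 -ce_adj hy.
have [a [b ->]] := ce_decomp (j g).
by rewrite ce_adjV !ce_dot_K2 (dot_adjr _ _ (Ub k)).
Qed.

Lemma ce_shift_K2 k h y g : j h = i2 y -> j g = i2 (U k y) -> T k h = g.
Proof.
move=> hy gy; apply: dot_ext => z.
by rewrite dot_conj -(ce_compress _ _ hy) -gy jI.2 -dot_conj.
Qed.

Let L := i2 @^-1` range j.

(** [H \cap K_2] is closed: it is the orthogonal complement in [K_2] of the
    projection of the complement of [H]. *)
Lemma ce_trace_biorth : orthc (orthc L) `<=` L.
Proof.
have -> : L = orthc (hom_adj i2 @` orthc (range j)).
  apply/seteqP; split=> y.
    move=> yL _ [k kj <-]; rewrite -isometry_dotr//.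
    by apply: dot_orth_sym; apply: kj.
  move=> yk; apply: (isometry_biorth jI) => k kj.
  by rewrite isometry_dotr//; apply: yk; exists k.
by rewrite triorth.
Qed.

(** Moving the adjoints across the inner product, [y] is orthogonal to all
    [U^{alpha*} w] with [w] in [L^\perp] iff every [U^alpha y] is in
    [L^{\perp\perp} = L].  These [y] form the largest [U]-invariant subspace of
    [L]. *)
Lemma ce_coreP y :
  orthc (cspan (\bigcup_(alpha in [set: 'I_d -> nat]) adj (opow U alpha) @` orthc L)) y
  <-> forall alpha, L (opow U alpha y).
Proof.
rewrite orthc_cspan; split=> [yA alpha|yA _ [alpha _ [w wL <-]]].
  apply: ce_trace_biorth => w wL; rewrite (dot_adjr _ _ (opow_bounded Ub alpha)).
  by apply: yA; exists alpha => //; exists w.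
rewrite -(dot_adjr _ _ (opow_bounded Ub alpha)).
by apply: dot_orth_sym; apply: wL; exact: yA.
Qed.

Section UnitaryPart.
Context (N : set H).
Context (Nred : reducing T N).
Context (Nnormal : forall k h, N h -> T k (adj (T k) h) = adj (T k) (T k h)).
Context (Nsum : forall h, N h -> \sum_k T k (adj (T k) h) = h).

(** Comparing [\sum_k |T_k^* g|^2 = |g|^2] with the same identity for [U], the
    [K_1]-components of [N] form a coinvariant set on which the column of the
    [M_k^*] is isometric. *)
Lemma unitary_part_K2 h : N h -> exists y, j h = i2 y.
Proof.
pose S := [set x | exists g y, N g /\ j g = i1 x + i2 y].
have S0 : forall x, S x -> x = 0.
  apply: (ampliation_coinvariant_eq0 (@ce_Mz_mult R d H T X)
    (@ce_K1_sum R d H T X) Mb (@ce_M_sum R d H T X)).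
    move=> k x [g [y [Ng gE]]]; exists (adj (T k) g), (adj (U k) y).
    by split; [exact: Nred.2|rewrite -ce_adj gE ce_adjV].
  move=> x [g [y [Ng gE]]].
  have : \sum_k dot (adj (T k) g) (adj (T k) g) = dot g g.
    rewrite -{4}(Nsum Ng) dot_sumr; apply: eq_bigr => k _.
    by rewrite (dot_adjl _ _ (Tb k)).
  rewrite -jI.2 gE ce_dot.
  under eq_bigr => k _ do rewrite -jI.2 -ce_adj gE ce_adjV ce_dot.
  by rewrite big_split/= (spherical_dot_adj Us) => /addIr.
move=> Nh; have [x [y hE]] := ce_decomp (j h).
by exists y; rewrite hE (S0 x) -?ce_inj2E//; exists h, y.
Qed.

(** [j (T_k h)] is the projection of [U_k y] to [H].  Since the squared norms on
    both sides add up to [|h|^2], nothing is lost in any of the projections. *)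
Lemma unitary_part_shift k h y : N h -> j h = i2 y -> i2 (U k y) = j (T k h).
Proof.
move=> Nh hy; pose c l := i2 (U l y) - j (T l h).
suff /(_ k)/eqP : forall l, c l = 0 by rewrite subr_eq0 => /eqP.
apply: sum_dotxx_eq0.
have cE l : dot (c l) (c l) = dot (U l y) (U l y) - dot (T l h) (T l h).
  rewrite /c dotBl !dotBr i2I.2 jI.2 (dot_conj (i2 _) (j _)).
  rewrite (ce_compress _ _ hy) conj_real ?ger0_real ?dotxx_ge0//.
  by rewrite subrr subr0.
rewrite (eq_bigr _ (fun l _ => cE l)) sumrB (spherical_dot Us).
rewrite -i2I.2 -hy jI.2 -{2}(Nsum Nh) dot_sumr -sumrB big1// => l _.
by rewrite (dot_adjr _ _ (Tb l)) Nnormal// subrr.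
Qed.

Lemma unitary_part_sub_core h : N h ->
  exists2 y, (forall alpha, L (opow U alpha y)) & i2 y = j h.
Proof.
move=> Nh; have [y hy] := unitary_part_K2 Nh.
exists y => // alpha.
pose L' := [set z | exists2 g, N g & j g = i2 z].
suff [g _ gE] : L' (opow U alpha y) by exists g.
have : L' y by exists h.
move: y {hy}; apply: (@opow_ind _ _ _ U (fun A => forall y, L' y -> L' (A y))).
- by [].
- by move=> A B AL BL y Ly; exact/AL/BL.
- move=> k y [g Ng gy]; exists (T k g); first exact: Nred.1.
  by rewrite (unitary_part_shift k Ng gy).
Qed.

End UnitaryPart.

(** The largest [U]-invariant subspace of [H \cap K_2], seen in [H]. *)
Definition ce_core : set H :=
  [set h | exists2 y, (forall alpha, L (opow U alpha y)) & j h = i2 y].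

(** On the core [U_k] stays inside [H], so its compression [T_k] agrees with it. *)
Lemma ce_core_shift k h y : (forall alpha, L (opow U alpha y)) -> j h = i2 y ->
  (forall alpha, L (opow U alpha (U k y))) /\ j (T k h) = i2 (U k y).
Proof.
move=> yL hy; have UL alpha : L (opow U alpha (U k y)) by rewrite -opowS.
split=> //; have [g _ gy] := UL (fun=> 0%N); rewrite opow0 in gy.
by rewrite (ce_shift_K2 hy gy).
Qed.

(** [U^alpha U_k^* y = U_k^* U^alpha y] by Fuglede's theorem, and [H \cap K_2] is
    invariant under [U_k^*]. *)
Lemma ce_core_adj k h y : (forall alpha, L (opow U alpha y)) -> j h = i2 y ->
  (forall alpha, L (opow U alpha (adj (U k) y))) /\
  j (adj (T k) h) = i2 (adj (U k) y).
Proof.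
move=> yL hy; split; last exact: ce_adj_K2.
move=> alpha; rewrite opow_commute; last first.
  by move=> l x; rewrite (spherical_fuglede Us).
have [g _ gy] := yL alpha.
by exists (adj (T k) g) => //; exact: ce_adj_K2.
Qed.

Lemma ce_core_reducing : reducing T ce_core.
Proof.
split=> k h [y yL hy].
  by have [UL Uy] := ce_core_shift k yL hy; exists (U k y).
by have [UL Uy] := ce_core_adj k yL hy; exists (adj (U k) y).
Qed.

Lemma ce_core_normal k h : ce_core h -> T k (adj (T k) h) = adj (T k) (T k h).
Proof.
move=> [y yL hy]; apply: (isometry_inj jI).
have [UL Uy] := ce_core_shift k yL hy; have [_ ->] := ce_core_adj k UL Uy.
have [UaL Uay] := ce_core_adj k yL hy; have [_ ->] := ce_core_shift k UaL Uay.
by case: Us => _ _ ->.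
Qed.

Lemma ce_core_sum h : ce_core h -> \sum_k T k (adj (T k) h) = h.
Proof.
move=> [y yL hy]; apply: (isometry_inj jI).
rewrite (linmap_sum jI.1) hy; have [_ _ _ Usum] := Us.
rewrite -{1}(Usum y) (linmap_sum i2I.1); apply: eq_bigr => k _.
have [UaL Uay] := ce_core_adj k yL hy.
by have [_ ->] := ce_core_shift k UaL Uay.
Qed.

End Coextension.

(** * Completely non-unitary complements *)

Section Compression.
Context (R : realType) (d : nat) (H : hilbertType R) (T : 'I_d -> H -> H).
Context (Tb : forall k, bounded_op (T k)).
Context (Tc : commuting T).

(** The projection [Q] onto the complement of [N] intertwines [T] and [T^*] with
    their restrictions, so it carries the identities of a spherical unitary from
    [A] to [Q A].  By complete non-unitarity [Q A = 0]. *)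
Lemma cnu_complement_sub (N : csubspace H) (A : set H) : reducing T N ->
  cnu (restr_tuple T (complement N)) -> reducing T A ->
  (forall k x, A x -> T k (adj (T k) x) = adj (T k) (T k x)) ->
  (forall x, A x -> \sum_k T k (adj (T k) x) = x) ->
  A `<=` N.
Proof.
move=> Nred Ncnu [TA TaA] An Asum.
have [inv inva] := reducing_orthc Tb Nred.
set N' := complement N in Ncnu *.
have N'inv : Defs.invariant T N' by [].
have N'inva : Defs.invariant (fun k => adj (T k)) N' by [].
pose T' := restr_tuple T N'.
have T'b k : bounded_op (T' k) by exact: restr_bounded.
pose v := (\val : subhilb N' -> H).
have vI : Defs.isometry v by exact: val_isometry.
pose Q := hom_adj v.
have QE x h : dot (v x) h = dot x (Q h) by exact: isometry_dotr.
have QT k h : Q (T k h) = T' k (Q h).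
  apply: dot_ext => x; rewrite -QE -(dot_adjl _ _ (Tb k)).
  by rewrite -(val_adj_restr N'inv Tb N'inva) QE (dot_adjl _ _ (T'b k)).
have QTa k h : Q (adj (T k) h) = adj (T' k) (Q h).
  apply: dot_ext => x; rewrite -QE -(dot_adjr _ _ (Tb k)).
  by rewrite -(val_restr N'inv) QE (dot_adjr _ _ (T'b k)).
have Qlin : linear Q.
  move=> a x y; apply: hom_adj_uniq => z.
  by rewrite !(dotDr, dotZr) !QE.
have T'c : commuting T'.
  by move=> k l x; apply: val_inj; rewrite !val_restr.
have QAred : reducing T' (Q @` A).
  split=> k _ [h Ah <-]; first by exists (T k h); [exact: TA|exact: QT].
  by exists (adj (T k) h); [exact: TaA|exact: QTa].
have QAs : spherical_unitary (restr_tuple T' (complement (orthc (Q @` A)))).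
  apply: spherical_unitary_biorth => //.
    by move=> k _ [h Ah <-]; rewrite -QTa -!QT -QTa An.
  move=> _ [h Ah <-]; rewrite -{2}(Asum h Ah) (linmap_sum Qlin).
  by apply: eq_bigr => k _; rewrite -QTa -QT.
have [QAinv _] := reducing_orthc T'b (reducing_orthc T'b QAred).
move=> h Ah; apply: csubspace_biorth => x xN.
have Qh0 : Q h = 0.
  by apply: (Ncnu (complement (orthc (Q @` A))) QAinv QAs); apply: sub_biorth; exists h.
have N'x : cs_set N' x by exact: xN.
pose x' : subhilb N' := SubHilb (introT (cs_predP _ _) N'x).
by apply: dot_orth_sym; rewrite -[x]/(v x') QE Qh0 dot0r.
Qed.

End Compression.

(** * The unitary part of [T] *)

Theorem theorem4p2 (R : realType) (d : nat) (hd : (0 < d)%N)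
    (H : hilbertType R) (T : 'I_d -> H -> H) (hT : row_contraction T)
    (X : coextension T) (hX : minimal X)
    (Hu : csubspace H) (hred : reducing T Hu)
    (hsu : spherical_unitary (restr_tuple T Hu))
    (hcnu : cnu (restr_tuple T (complement Hu))) :
  ce_emb X @` Hu =
  ce_inj2 X @` orthc (cspan (\bigcup_(alpha in [set: 'I_d -> nat])
    adj (opow (ce_U X) alpha) @` orthc (ce_inj2 X @^-1` range (ce_emb X)))).
Proof.
have [Tb Tc _] := hT.
have Hus := (spherical_restrP hred.1 Tb hred.2 Tc).1 hsu.
apply/seteqP; split=> [_ [h hHu <-]|_ [y /ce_coreP yL <-]].
  have [y yL yh] := unitary_part_sub_core Tb X hred
    (fun k g gHu => (Hus g gHu).1 k) (fun g gHu => (Hus g gHu).2) hHu.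
  by exists y => //; apply/ce_coreP.
have [h _ hy] := yL (fun=> 0%N); rewrite opow0 in hy.
exists h => //; apply: (cnu_complement_sub Tb Tc hred hcnu (A := ce_core X)).
- exact: ce_core_reducing.
- by move=> k x; exact: ce_core_normal.
- by move=> x; exact: ce_core_sum.
- by exists y.
Qed.
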